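(* Suppose the $L$-smoothness assumption and the PL-condition with constant $\mu>0$ hold, and let $\{w_t\}_{t\ge0}$, $\{v_t\}_{t\ge0}$, $\{\hat D_t\}_{t\ge0}$ be generated by {\tt Scaled SARAH} with any step-size $\eta>0$. Then for every $t\ge0$, $$P(w_{t+1})-P^*\le\left(1-\frac{\eta\mu}{\Gamma}\right)(P(w_t)-P^* )+\frac{\eta}{2\alpha}\|\nabla P(w_t)-v_t\|^2-\left(\frac1{2\eta}-\frac{L}{2\alpha}\right)\|w_{t+1}-w_t\|^2_{\hat D_t}.$$
   Context: $P=\frac1n\sum_{i=1}^nf_i$ with $f_i:\mathbb{R}^d\to\mathbb{R}$, assumed to have a minimizer $w^*$, $P^*=P(w^* )$. $L$-smoothness assumption: each $f_i$ and $P$ are twice differentiable with $L$-Lipschitz gradients. PL-condition: $\|\nabla P(w)\|^2\ge2\mu(P(w)-P^* )$ for all $w$. $\Gamma=\sqrt d\,L$. $\|x\|_D^2=x^TDx$. For $J\subseteq[n]$, $\nabla^2P_J(w)=\frac1{|J|}\sum_{j\in J}\nabla^2 f_j(w)$; $\odot$ is the Hadamard product; $\mathrm{diag}(x)$ is the diagonal matrix with the entries of $x$. Preconditioner (parameters $\alpha>0$, $\beta\in(0,1)$, $m\ge1$): $D_0=\frac1m\sum_{j=1}^m\mathrm{diag}(z_j\odot\nabla^2P_{\mathcal{J}_j}(w_0)z_j)$, $D_t=\beta D_{t-1}+(1-\beta)\mathrm{diag}(z_t\odot\nabla^2P_{\mathcal{J}_t}(w_t)z_t)$ for $t\ge1$,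 with independent Rademacher vectors $z$ and random index sets $\mathcal{J}\subseteq[n]$; $\hat D_t$ diagonal with $(\hat D_t)_{ii}=\max\{\alpha,|(D_t)_{ii}|\}$. {\tt Scaled SARAH} (input $w_0$, $\eta$, $p\in(0,1]$): $v_0=\nabla P(w_0)$; for $t\ge0$: $w_{t+1}=w_t-\eta\hat D_t^{-1}v_t$; draw $i_{t+1}$ uniformly from $[n]$; with probability $p$, $v_{t+1}=\nabla P(w_{t+1})$, otherwise $v_{t+1}=v_t+\nabla f_{i_{t+1}}(w_{t+1})-\nabla f_{i_{t+1}}(w_t)$; update $\hat D_{t+1}$.
   Formalization: The preconditioner parameter α is assumed to satisfy α ≤ Γ = √d L as well as α > 0. The paper assumes this as well. *)

(* Defs.v *)
From HB Require Import structures.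
From mathcomp Require Import all_boot all_order all_algebra.
From mathcomp Require Import all_classical all_reals all_analysis.
Set Implicit Arguments. Unset Strict Implicit. Unset Printing Implicit Defensive.
Import Order.TTheory GRing.Theory Num.Theory.
Import numFieldNormedType.Exports.
Local Open Scope ring_scope.

Section Defs.
Variables (R : realType) (d : nat).

Definition dotv (x y : 'rV[R]_d) : R := \sum_(i < d) x 0 i * y 0 i.
Definition sqnorm (x : 'rV[R]_d) : R := \sum_(i < d) x 0 i ^+ 2.
Definition enorm (x : 'rV[R]_d) : R := Num.sqrt (sqnorm x).
(* ||x||_D^2 = x^T D x for the diagonal matrix D = diag(Dd) *)
Definition sqnormD (Dd x : 'rV[R]_d) : R := \sum_(i < d) Dd 0 i * x 0 i ^+ 2.

Definition is_gradient (f : 'rV[R]_d -> R) (g : 'rV[R]_d -> 'rV[R]_d) : Prop :=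
  forall x, differentiable f x /\
    ('d f x : 'rV[R]_d -> R) = (fun u => dotv u (g x)).

Definition is_hessian (g : 'rV[R]_d -> 'rV[R]_d) (H : 'rV[R]_d -> 'M[R]_d) : Prop :=
  forall x, differentiable g x /\
    ('d g x : 'rV[R]_d -> 'rV[R]_d) = (fun u => u *m (H x)^T).

Definition lipschitz_eucl (L : R) (g : 'rV[R]_d -> 'rV[R]_d) : Prop :=
  forall x y, enorm (g x - g y) <= L * enorm (x - y).

(* diag(z ⊙ (A z)) stored as the row vector of its diagonal entries *)
Definition hutch_diag (A : 'M[R]_d) (z : 'rV[R]_d) : 'rV[R]_d :=
  \row_i (z 0 i * \sum_(j < d) A i j * z 0 j).

Definition rademacher (z : 'rV[R]_d) : Prop :=
  forall i, z 0 i = 1 \/ z 0 i = -1.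

Definition Dhat (alpha : R) (Dd : 'rV[R]_d) : 'rV[R]_d :=
  \row_i Num.max alpha `|Dd 0 i|.

End Defs.

Definition hessJ (R : realType) (d n : nat) (H : 'I_n -> 'rV[R]_d -> 'M[R]_d)
  (J : {set 'I_n}) (w : 'rV[R]_d) : 'M[R]_d :=
  (#|J|%:R)^-1 *: \sum_(j in J) H j w.

Definition Pavg (R : realType) (d n : nat) (f : 'I_n -> 'rV[R]_d -> R)
  (w : 'rV[R]_d) : R := (n%:R)^-1 * \sum_(i < n) f i w.

Definition gradPavg (R : realType) (d n : nat) (g : 'I_n -> 'rV[R]_d -> 'rV[R]_d)
  (w : 'rV[R]_d) : 'rV[R]_d := (n%:R)^-1 *: \sum_(i < n) g i w.

(* Main.v *)
(* Let Delta = w_{t+1} - w_t = -eta Dhat_t^{-1} v_t.  The descent lemma bounds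
   P(w_{t+1}) by P(w_t) + <Delta, grad P(w_t)> + L/2 |Delta|^2.  Coordinatewise,
   -2ab = (a - b)^2 - a^2 - b^2 turns the inner product into a combination of
   |grad P - v|^2 and |grad P|^2 with weights eta/(2 (Dhat_t)_ii), minus
   |Delta|^2_{Dhat_t} / (2 eta); since alpha <= (Dhat_t)_ii <= Gamma these weights
   lie between eta/(2 Gamma) and eta/(2 alpha), and PL bounds |grad P(w_t)|^2
   below by 2 mu times the optimality gap.  The upper bound on Dhat_t holds because the
   Hessians have operator norm at most L, so every Hutchinson estimate
   z_i (H z)_i with |z| = sqrt d is at most sqrt d L = Gamma in absolute value,
   and D_0 is an average, and D_{t+1} a convex combination, of such estimates. *)

Require Import Defs.
From HB Require Import structures.
From mathcomp Require Import all_boot all_order all_algebra.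
From mathcomp Require Import all_classical all_reals all_analysis.
From mathcomp Require Import ring lra.
Set Implicit Arguments.
Unset Strict Implicit.
Unset Printing Implicit Defensive.

Import Order.TTheory GRing.Theory Num.Theory.
Import numFieldNormedType.Exports.
Local Open Scope ring_scope.

Lemma scaled_step_coord_le (R : realFieldType) (eta alpha G L Dh a b s : R) :
  0 < eta -> 0 < alpha -> 0 <= L -> alpha <= Dh <= G -> s = - (eta / Dh * b) ->
  s * a + L / 2 * s ^+ 2 <=
    eta / (2 * alpha) * (a - b) ^+ 2 - eta / (2 * G) * a ^+ 2
    - (1 / (2 * eta) - L / (2 * alpha)) * (Dh * s ^+ 2).
Proof.
move=> e0 a0 L0 /andP[aD DG] hs.
have D0 : 0 < Dh := lt_le_trans a0 aD.
have -> : s * a = eta / (2 * Dh) * ((a - b) ^+ 2 - a ^+ 2) - 1 / (2 * eta) * (Dh * s ^+ 2).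
  by rewrite hs; field; rewrite !gt_eqF.
have curvature_le : L / 2 * s ^+ 2 <= L / (2 * alpha) * (Dh * s ^+ 2).
  rewrite -subr_ge0.
  have -> : L / (2 * alpha) * (Dh * s ^+ 2) - L / 2 * s ^+ 2 =
      L / (2 * alpha) * ((Dh - alpha) * s ^+ 2) by field; rewrite gt_eqF.
  apply: mulr_ge0; first by rewrite mulr_ge0 // invr_ge0 mulr_ge0 // ltW.
  by rewrite mulr_ge0 ?sqr_ge0 // subr_ge0.
have weight_le (x y c : R) : 0 < x -> x <= y -> 0 <= c ->
    eta / (2 * y) * c <= eta / (2 * x) * c.
  move=> x0 xy c0; apply: (ler_wpM2r c0); apply: (ler_wpM2l (ltW e0)).
  by rewrite lef_pV2 ?posrE; lra.
have := weight_le _ _ _ a0 aD (sqr_ge0 (a - b)).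
have := weight_le _ _ _ D0 DG (sqr_ge0 a).
lra.
Qed.

Section Vectors.
Variables (R : realType) (d : nat).
Implicit Types (x y : 'rV[R]_d) (c : R).

Lemma sqnorm_ge0 x : 0 <= sqnorm x.
Proof. by apply: sumr_ge0 => i _; rewrite sqr_ge0. Qed.

Lemma enorm_ge0 x : 0 <= enorm x.
Proof. exact: sqrtr_ge0. Qed.

Lemma enorm_sqr x : enorm x ^+ 2 = sqnorm x.
Proof. by rewrite sqr_sqrtr // sqnorm_ge0. Qed.

Lemma sqnormZ c x : sqnorm (c *: x) = c ^+ 2 * sqnorm x.
Proof. by rewrite /sqnorm mulr_sumr; apply: eq_bigr => i _; rewrite mxE exprMn. Qed.

Lemma enormZ c x : enorm (c *: x) = `|c| * enorm x.
Proof. by rewrite /enorm sqnormZ sqrtrM ?sqr_ge0 // sqrtr_sqr. Qed.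

Lemma normr_coord_le_enorm x i : `|x 0 i| <= enorm x.
Proof.
rewrite /enorm -sqrtr_sqr; apply: ler_wsqrtr.
by rewrite /sqnorm (bigD1 i) //= lerDl; apply: sumr_ge0 => j _; exact: sqr_ge0.
Qed.

Lemma sqnorm_rademacher x : rademacher x -> sqnorm x = d%:R.
Proof.
move=> hx; rewrite /sqnorm (eq_bigr (fun _ => 1)) ?sumr_const ?card_ord //.
by move=> i _; case: (hx i) => ->; rewrite ?sqrrN expr1n.
Qed.

Lemma dotvBr x y y' : dotv x (y - y') = dotv x y - dotv x y'.
Proof. by rewrite /dotv -sumrB; apply: eq_bigr => i _; rewrite !mxE mulrBr. Qed.

Lemma dotv_young x y c : 0 < c -> 2 * dotv x y <= c * sqnorm x + c^-1 * sqnorm y.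
Proof.
move=> c0; rewrite /dotv /sqnorm !mulr_sumr -big_split /=.
apply: ler_sum => i _; rewrite -subr_ge0.
have -> : c * x 0 i ^+ 2 + c^-1 * y 0 i ^+ 2 - 2 * (x 0 i * y 0 i)
    = (c * x 0 i - y 0 i) ^+ 2 * c^-1 by field; rewrite gt_eqF.
by rewrite mulr_ge0 ?sqr_ge0 // invr_ge0 ltW.
Qed.

Lemma scaled_step_le (eta alpha G L : R) (Dh a b s : 'rV[R]_d) :
  0 < eta -> 0 < alpha -> 0 <= L -> (forall i, alpha <= Dh 0 i <= G) ->
  (forall i, s 0 i = - (eta / Dh 0 i * b 0 i)) ->
  dotv s a + L / 2 * sqnorm s <=
    eta / (2 * alpha) * sqnorm (a - b) - eta / (2 * G) * sqnorm a
    - (1 / (2 * eta) - L / (2 * alpha)) * sqnormD Dh s.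
Proof.
move=> e0 a0 L0 hDh hs; rewrite /dotv /sqnorm /sqnormD !mulr_sumr -big_split -!sumrB /=.
apply: ler_sum => i _; rewrite [(a - b) 0 i]mxE [(- b) 0 i]mxE.
exact: scaled_step_coord_le.
Qed.

End Vectors.

Section Preconditioner.
Variables (R : realType) (d : nat).
Implicit Types (x y : 'rV[R]_d) (G : R).

Lemma avg_coord_le (m : nat) (x : 'I_m -> 'rV[R]_d) G i :
  (0 < m)%N -> (forall j, `|x j 0 i| <= G) ->
  `|((m%:R)^-1 *: \sum_(j < m) x j) 0 i| <= G.
Proof.
move=> m0 hx; rewrite mxE summxE normrM ger0_norm ?invr_ge0 ?ler0n //.
rewrite ler_pdivrMl ?ltr0n //.
apply: le_trans (ler_norm_sum _ _ _) _.
by apply: le_trans (ler_sum _ (fun j _ => hx j)) _; rewrite sumr_const card_ord mulr_natl.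
Qed.

Lemma convex_coord_le (beta G : R) x y i :
  0 <= beta <= 1 -> `|x 0 i| <= G -> `|y 0 i| <= G ->
  `|(beta *: x + (1 - beta) *: y) 0 i| <= G.
Proof.
move=> /andP[b0 b1] hx hy; rewrite !mxE; apply: le_trans (ler_normD _ _) _.
have b1' : 0 <= 1 - beta by rewrite subr_ge0.
rewrite !normrM (ger0_norm b0) (ger0_norm b1').
have := ler_wpM2l b0 hx; have := ler_wpM2l b1' hy; lra.
Qed.

Lemma ema_coord_le (m : nat) (beta G : R) (x0 : 'I_m -> 'rV[R]_d) (x D : nat -> 'rV[R]_d) :
  (0 < m)%N -> 0 <= beta <= 1 ->
  (forall j i, `|x0 j 0 i| <= G) -> (forall t i, `|x t 0 i| <= G) ->
  D 0%N = (m%:R)^-1 *: \sum_(j < m) x0 j ->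
  (forall t, D t.+1 = beta *: D t + (1 - beta) *: x t.+1) ->
  forall t i, `|D t 0 i| <= G.
Proof.
move=> m0 hbeta hx0 hx D0 DS; elim=> [|t IH] i.
  by rewrite D0; apply: avg_coord_le.
by rewrite DS; apply: convex_coord_le.
Qed.

Lemma Dhat_coord_ge (alpha : R) (D : 'rV[R]_d) i : alpha <= Dhat alpha D 0 i.
Proof. by rewrite mxE le_max lexx. Qed.

Lemma Dhat_coord_le (alpha G : R) (D : 'rV[R]_d) i :
  alpha <= G -> `|D 0 i| <= G -> Dhat alpha D 0 i <= G.
Proof. by rewrite mxE ge_max => -> ->. Qed.

End Preconditioner.

Section Hessian.
Variables (R : realType) (d : nat).
Local Open Scope classical_set_scope.

Lemma hessian_coord_le (g : 'rV[R]_d -> 'rV[R]_d) (H : 'rV[R]_d -> 'M[R]_d) L x u i :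
  0 <= L -> is_hessian g H -> lipschitz_eucl L g ->
  `|(u *m (H x)^T) 0 i| <= L * enorm u.
Proof.
move=> L0 hH hL; have [dg dE] := hH x.
have -> : u *m (H x)^T = 'D_u g x by rewrite deriveE // dE.
have quotient_le h : `|(h^-1 *: (g (h *: u + x) - g x)) 0 i| <= L * enorm u.
  rewrite mxE normrM normfV.
  have [->|h0] := eqVneq h 0; first by rewrite normr0 invr0 mul0r mulr_ge0 ?enorm_ge0.
  rewrite ler_pdivrMl ?normr_gt0 //.
  apply: le_trans (normr_coord_le_enorm _ _) _.
  by apply: le_trans (hL _ _) _; rewrite addrK enormZ mulrCA.
have cvg_quotient : (fun h : R => `|(h^-1 *: (g (h *: u + x) - g x)) 0 i|) @ 0^'
    --> `|('D_u g x) 0 i|.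
  have cvg_D : (fun h : R => h^-1 *: (g (h *: u + x) - g x)) @ 0^' --> 'D_u g x.
    exact: (diff_derivable (v:=u) dg).
  exact: cvg_norm (cvg_comp _ _ cvg_D (@coord_continuous _ 1 d 0 i _)).
by apply: (cvgr_to_le cvg_quotient); near=> h; exact: quotient_le.
Unshelve. all: by end_near.
Qed.

Lemma hutch_diag_hessJ_le (n : nat) (g : 'I_n -> 'rV[R]_d -> 'rV[R]_d)
    (H : 'I_n -> 'rV[R]_d -> 'M[R]_d) L (J : {set 'I_n}) w z i :
  0 <= L -> (forall k, is_hessian (g k) (H k)) -> (forall k, lipschitz_eucl L (g k)) ->
  rademacher z -> (0 < #|J|)%N ->
  `|hutch_diag (hessJ H J w) z 0 i| <= Num.sqrt d%:R * L.
Proof.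
move=> L0 hH hL hz hJ.
have hessJ_row : \sum_(j < d) hessJ H J w i j * z 0 j
    = (#|J|%:R)^-1 * \sum_(k in J) (z *m (H k w)^T) 0 i.
  transitivity ((#|J|%:R)^-1 * \sum_(j < d) \sum_(k in J) H k w i j * z 0 j).
    by rewrite mulr_sumr; apply: eq_bigr => j _; rewrite !mxE summxE -mulrA mulr_suml.
  rewrite exchange_big; congr (_ * _); apply: eq_bigr => k _.
  by rewrite !mxE; apply: eq_bigr => j _; rewrite !mxE mulrC.
rewrite /hutch_diag mxE normrM hessJ_row.
have -> : `|z 0 i| = 1 by case: (hz i) => ->; rewrite ?normrN normr1.
rewrite mul1r normrM ger0_norm ?invr_ge0 ?ler0n // ler_pdivrMl ?ltr0n //.
apply: le_trans (ler_norm_sum _ _ _) _.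
have row_le k : `|(z *m (H k w)^T) 0 i| <= Num.sqrt d%:R * L.
  by rewrite mulrC -(sqnorm_rademacher hz); exact: hessian_coord_le.
by apply: le_trans (ler_sum _ (fun k _ => row_le k)) _; rewrite sumr_const mulr_natl.
Qed.

End Hessian.

Section Descent.
Variables (R : realType) (d : nat).
Local Open Scope classical_set_scope.
Implicit Types (x y D : 'rV[R]_d).

Lemma is_derive_line (P : 'rV[R]_d -> R) (g : 'rV[R]_d -> 'rV[R]_d) x D (s : R) :
  is_gradient P g ->
  is_derive s 1 (fun s : R => P (s *: D + x)) (dotv D (g (s *: D + x))).
Proof.
move=> hg; have [dP dE] := hg (s *: D + x).
have quotientE :
    (fun h : R => h^-1 *: (((fun s => P (s *: D + x)) \o shift s) (h *: 1) - P (s *: D + x)))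
    = (fun h => h^-1 *: ((P \o shift (s *: D + x)) (h *: D) - P (s *: D + x))).
  by apply/funext => h /=; rewrite [h%:A]mulr1 scalerDl addrA.
have dv : derivable P (s *: D + x) D := diff_derivable (v:=D) dP.
apply: DeriveDef; first by rewrite /derivable quotientE.
by rewrite /derive quotientE -/(derive _ _ _) deriveE // dE.
Qed.

Lemma dotv_lipschitz_increment_le (g : 'rV[R]_d -> 'rV[R]_d) (L c : R) x D :
  0 < L -> 0 < c -> lipschitz_eucl L g ->
  dotv D (g (c *: D + x) - g x) <= c * L * sqnorm D.
Proof.
move=> L0 c0 hL; set e := g (c *: D + x) - g x.
have Lc0 : 0 < L * c by rewrite mulr_gt0.
have e_le : sqnorm e <= (L * c) ^+ 2 * sqnorm D.
  rewrite -!enorm_sqr -exprMn ler_sqr ?nnegrE ?enorm_ge0 //;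
    last by rewrite mulr_ge0 ?enorm_ge0 ?ltW.
  by have := hL (c *: D + x) x; rewrite addrK enormZ gtr0_norm // mulrA.
have : (L * c)^-1 * sqnorm e <= L * c * sqnorm D.
  by rewrite ler_pdivrMl // mulrA -expr2.
have := dotv_young D e Lc0; lra.
Qed.

Lemma smooth_upper_bound (P : 'rV[R]_d -> R) (g : 'rV[R]_d -> 'rV[R]_d) L x y :
  0 < L -> is_gradient P g -> lipschitz_eucl L g ->
  P y <= P x + dotv (y - x) (g x) + L / 2 * sqnorm (y - x).
Proof.
move=> L0 hg hL; set D := y - x; set c1 := dotv D (g x); set c2 := L / 2 * sqnorm D.
pose psi s := P (s *: D + x) - (s * c1 + s ^+ 2 * c2).
have dpsi (s : R) : is_derive s 1 psi (dotv D (g (s *: D + x)) - (c1 + 2 * s * c2)).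
  have : is_derive s 1 (fun s : R => s * c1 + s ^+ 2 * c2) (c1 + 2 * s * c2).
    by apply: is_derive_eq; rewrite !scaler0 !add0r /GRing.scale /=; ring.
  exact: is_deriveB (is_derive_line _ _ _ hg).
have psi_cont : {within `[0, 1], continuous psi}.
  by apply: derivable_within_continuous => s _; case: (dpsi s).
have [c c01 psiE] := MVT ltr01 (fun s _ => dpsi s) psi_cont.
have c0 : 0 < c by move: c01; rewrite in_itv /= => /andP[].
have := dotv_lipschitz_increment_le x D L0 c0 hL; rewrite dotvBr -/c1.
move: psiE; rewrite /psi subr0 mulr1 scale1r scale0r add0r /D subrK mul0r expr0n /=.
rewrite mul0r addr0 subr0 expr1n !mul1r -/D /c2; lra.
Qed.

End Descent.

Theorem lemma3 (R : realType) (d n : nat)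
  (f : 'I_n -> 'rV[R]_d -> R)
  (g : 'I_n -> 'rV[R]_d -> 'rV[R]_d)
  (H : 'I_n -> 'rV[R]_d -> 'M[R]_d)
  (HP : 'rV[R]_d -> 'M[R]_d)
  (L mu : R) (wstar : 'rV[R]_d)
  (alpha beta eta p : R) (m : nat)
  (z0 : 'I_m -> 'rV[R]_d) (J0 : 'I_m -> {set 'I_n})
  (z : nat -> 'rV[R]_d) (J : nat -> {set 'I_n})
  (idx : nat -> 'I_n) (coin : nat -> bool)
  (w v Dd : nat -> 'rV[R]_d) :
  (0 < n)%N ->
  (* L-smoothness *)
  (forall i, is_gradient (f i) (g i)) ->
  (forall i, is_hessian (g i) (H i)) ->
  (forall i, lipschitz_eucl L (g i)) ->
  is_gradient (Pavg f) (gradPavg g) ->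
  is_hessian (gradPavg g) HP ->
  lipschitz_eucl L (gradPavg g) ->
  (* minimizer *)
  (forall w', Pavg f wstar <= Pavg f w') ->
  (* PL condition *)
  0 < mu ->
  (forall w', 2 * mu * (Pavg f w' - Pavg f wstar) <= sqnorm (gradPavg g w')) ->
  (* preconditioner parameters (see NOTES: alpha <= Gamma) *)
  0 < alpha -> alpha <= Num.sqrt (d%:R) * L ->
  0 < beta -> beta < 1 -> (0 < m)%N ->
  0 < p -> p <= 1 ->
  0 < eta ->
  (* Rademacher vectors and (nonempty) index sets *)
  (forall j, rademacher (z0 j)) -> (forall t, rademacher (z t)) ->
  (forall j, (0 < #|J0 j|)%N) -> (forall t, (0 < #|J t|)%N) ->
  (* preconditioner recursion *)
  Dd 0%N = (m%:R)^-1 *: \sum_(j < m) hutch_diag (hessJ H (J0 j) (w 0%N)) (z0 j) ->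
  (forall t, Dd t.+1 = beta *: Dd t
                     + (1 - beta) *: hutch_diag (hessJ H (J t.+1) (w t.+1)) (z t.+1)) ->
  (* Scaled SARAH *)
  v 0%N = gradPavg g (w 0%N) ->
  (forall t i, w t.+1 0 i = w t 0 i - eta * (Dhat alpha (Dd t) 0 i)^-1 * v t 0 i) ->
  (forall t, v t.+1 = if coin t.+1 then gradPavg g (w t.+1)
                      else v t + g (idx t.+1) (w t.+1) - g (idx t.+1) (w t)) ->
  forall t : nat,
    Pavg f (w t.+1) - Pavg f wstar <=
      (1 - eta * mu / (Num.sqrt (d%:R) * L)) * (Pavg f (w t) - Pavg f wstar)
      + eta / (2 * alpha) * sqnorm (gradPavg g (w t) - v t)
      - (1 / (2 * eta) - L / (2 * alpha)) * sqnormD (Dhat alpha (Dd t)) (w t.+1 - w t).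
Proof.
move=> _ _ hH hL hgP _ hLP _ _ hPL a0 aG b0 b1 m0 _ _ e0 hz0 hz hJ0 hJ hD0 hDS _ hw _ t.
set G := Num.sqrt d%:R * L.
have G0 : 0 < G := lt_le_trans a0 aG.
have L0 : 0 < L by move: G0; have := sqrtr_ge0 (d%:R : R); rewrite /G; nra.
have hutch_le (J' : {set 'I_n}) w' z' i : rademacher z' -> (0 < #|J'|)%N ->
    `|hutch_diag (hessJ H J' w') z' 0 i| <= G.
  by move=> hz' hJ'; apply: hutch_diag_hessJ_le (ltW L0) hH hL hz' hJ'.
have Dd_le : forall s i, `|Dd s 0 i| <= G.
  apply: (ema_coord_le (x := fun s => hutch_diag (hessJ H (J s) (w s)) (z s)) m0 _ _ _ hD0 hDS).
  - by rewrite (ltW b0) (ltW b1).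
  - by move=> j i; apply: hutch_le.
  - by move=> s i; apply: hutch_le.
have Dhat_range i : alpha <= Dhat alpha (Dd t) 0 i <= G.
  by rewrite Dhat_coord_ge Dhat_coord_le.
have step_coords i : (w t.+1 - w t) 0 i = - (eta / Dhat alpha (Dd t) 0 i * v t 0 i).
  by rewrite [LHS]mxE [(- w t) 0 i]mxE hw addrAC subrr add0r.
have := scaled_step_le (gradPavg g (w t)) e0 a0 (ltW L0) Dhat_range step_coords.
have := smooth_upper_bound (w t) (w t.+1) L0 hgP hLP.
have PL_weighted : eta * mu / G * (Pavg f (w t) - Pavg f wstar)
    <= eta / (2 * G) * sqnorm (gradPavg g (w t)).
  have -> : eta * mu / G * (Pavg f (w t) - Pavg f wstar)
      = eta / (2 * G) * (2 * mu * (Pavg f (w t) - Pavg f wstar)) by field; rewrite gt_eqF.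
  by apply: ler_wpM2l (hPL _); rewrite divr_ge0 ?mulr_ge0 // ltW.
lra.
Qed.
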